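(* Any augmented wholesale price contract $(w,\rho)\in\mathbb{R}^2$ with $w+\rho\lambda=r$ coordinates the decentralized supply chain, i.e. $\hat{x}(w,\rho)=x^*$. Moreover, set $$\hat{w}=k+c+\frac{c}{b\lambda+1}\ln\left(\frac{r-k}{c}\right),\qquad \hat{\rho}=\frac{1}{\lambda}\left(r-k-c-\frac{c}{b\lambda+1}\ln\left(\frac{r-k}{c}\right)\right).$$ Then $\hat\rho\ge 0$, the contract $(\hat w,\hat\rho)$ is coordinating, and among all coordinating contracts $(w,\rho)$ for which the supplier participates (that is, $\hat{\pi}_s(\hat{x}(w,\rho),w,\rho)\ge 0$), it maximizes the OEM's profit $\hat{\pi}_m(w,\rho)$. Under $(\hat{w},\hat{\rho})$ the OEM extracts the entire surplus: writing $\hat\pi_s=\hat{\pi}_s(\hat{x}(\hat w,\hat\rho),\hat w,\hat\rho)$ and $\hat\pi_m=\hat\pi_m(\hat w,\hat\rho)$, one has $\hat{\pi}_s=0$, $\hat{\pi}_m=\Pi^*$, and $\hat{\pi}_s+\hat{\pi}_m=\Pi^*$.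
   Context: Parameters: capacity cost $c>0$ per unit, production cost $k\ge 0$ per unit, retail price $r$ with $r-k-c>c$, base demand $b\ge 0$, rate $\lambda>0$ with $\frac1\lambda\ge b$. Demand is $D=b+A$ with $A\sim \mathrm{Exp}(\lambda)$ (mean $1/\lambda$). Centralized benchmark: for capacity $x$, $\Pi(x)=-cx+\mathbb{E}[(r-k)\min\{b+A,x\}]$; its maximizer is $x^*=b+\frac1\lambda\ln\left(\frac{r-k}{c}\right)$ with maximum value $\Pi^*=(r-k-c)\left(b+\frac1\lambda\right)-\frac c\lambda\ln\left(\frac{r-k}{c}\right)$. Augmented wholesale price contract $(w,\rho)$: the OEM pays $w$ per delivered unit, and the supplier pays the OEM the lump sum $\rho$ if demand exceeds the supplier's capacity $x$. The supplier's expected profit is $$\hat{\pi}_s(x,w,\rho)=-cx+\mathbb{E}\left[(w-k)\min\{b+A,x\}-\rho\,1_{\{b+A>x\}}\right].$$ The supplier's capacity response, obtained from the first order condition in $x$ (for $x>b$), is $$\hat{x}(w,\rho)=b+\frac1\lambda\ln\left(\frac{w-k+\rho\lambda}{c}\right),$$ and the OEM's resulting profit is $$\hat{\pi}_m(w,\rho)=\mathbb{E}\left[(r-w)\min\{b+A,\hat{x}(w,\rho)\}+\rho\,1_{\{b+A\ge \hat{x}(w,\rho)\}}\right].$$ A contract is called coordinating if $\hat{x}(w,\rho)=x^*$. *)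

(* Defs.v *)
From mathcomp Require Import all_boot all_order all_algebra.
From mathcomp Require Import all_classical all_reals all_analysis.
From mathcomp Require Import measurable_realfun ring.

Set Implicit Arguments.
Unset Strict Implicit.
Unset Printing Implicit Defensive.

Import Order.TTheory GRing.Theory Num.Theory.
Import numFieldNormedType.Exports.
Local Open Scope classical_set_scope.
Local Open Scope ring_scope.

(* Throughout, [c] is the capacity cost, [k] the production cost, [r] the retail
   price, [b] the base demand and [lambda] the rate of the random demand [A]. *)

Definition exponentially_distributed (R : realType) (d : measure_display)
    (T : measurableType d) (P : probability T R) (A : {RV P >-> R})
    (lambda : R) : Prop :=
  (* the two set functions are only meant to agree on Borel sets *)
  forall B : set R, measurable B ->
    distribution P A B = exponential_prob lambda B.

Section supply_chain.
Context (R : realType) (d : measure_display) (T : measurableType d).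
Context (P : probability T R) (A : {RV P >-> R}).
Variables (c k r b lambda : R).

Definition centralized_profit (x : R) : \bar R :=
  ((- (c * x))%:E + 'E_P[fun t => ((r - k) * Num.min (b + A t) x)%R])%E.

Definition optimal_capacity : R := b + lambda^-1 * ln ((r - k) / c).

Definition optimal_profit : R :=
  (r - k - c) * (b + lambda^-1) - c / lambda * ln ((r - k) / c).

Definition supplier_profit (x w rho : R) : \bar R :=
  ((- (c * x))%:E +
   'E_P[fun t => ((w - k) * Num.min (b + A t) x
                  - rho * \1_[set u | x < b + A u] t)%R])%E.

Definition capacity_response (w rho : R) : R :=
  b + lambda^-1 * ln ((w - k + rho * lambda) / c).

Definition oem_profit (w rho : R) : \bar R :=
  let x := capacity_response w rho in
  'E_P[fun t => ((r - w) * Num.min (b + A t) x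
                 + rho * \1_[set u | x <= b + A u] t)%R]%E.

(* [ln] is extended by [0] to nonpositive reals.  When [r - k > c > 0], as in the
   standing assumptions, [optimal_capacity] exceeds [b], so such a junk value
   never makes a contract coordinating. *)
Definition coordinating (w rho : R) : Prop :=
  capacity_response w rho = optimal_capacity.

Definition supplier_participates (w rho : R) : Prop :=
  (0 <= supplier_profit (capacity_response w rho) w rho)%E.

Definition w_hat : R := k + c + c / (b * lambda + 1) * ln ((r - k) / c).

Definition rho_hat : R :=
  lambda^-1 * (r - k - c - c / (b * lambda + 1) * ln ((r - k) / c)).

End supply_chain.

(* Justification of the closed forms above: [optimal_capacity] maximizes
   [centralized_profit], with maximum value [optimal_profit]. *)
Section centralized_benchmark.
Context (R : realType) (d : measure_display) (T : measurableType d).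
Context (P : probability T R) (A : {RV P >-> R}).
Variables (c k r b lambda : R).
Hypotheses (c0 : 0 < c) (hrkc : c < r - k - c) (l0 : 0 < lambda).
Hypothesis Aexp : exponentially_distributed A lambda.

Let PA (B : set R) (mB : measurable B) : P (A @^-1` B) = exponential_prob lambda B.
Proof. by rewrite -(Aexp mB). Qed.

Let PAlt0 : P (A @^-1` `]-oo, 0[) = 0%E.
Proof.
rewrite PA//; apply: integral0_eq => x /=; rewrite in_itv/= => x0.
by rewrite lt0_exponential_pdf.
Qed.

Let A_ge0 : {ae P, forall t, 0 <= A t}.
Proof.
exists (A @^-1` `]-oo, 0[); split => //.
  exact: measurable_funPTI.
by move=> t /= /negP; rewrite -ltNge in_itv.
Qed.

Let PAgt (s : R) : 0 <= s ->
  P (A @^-1` `]s, +oo[) = (expR (- lambda * s))%:E.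
Proof.
move=> s0.
have mpre B : measurable B -> measurable (A @^-1` B).
  by move=> mB; have := @measurable_funPTI _ _ _ _ A; apply.
have -> : A @^-1` `]s, +oo[ = ~` (A @^-1` `]-oo, 0[ `|` A @^-1` `[0, s]).
  apply/seteqP; split => t /=; rewrite !in_itv/= andbT.
    by move=> st [|/andP[_]]; rewrite ?leNgt ?st// ltNge (le_trans s0 (ltW st)).
  by move=> h; rewrite ltNge; apply/negP => ts; apply: h; case: (ltP (A t) 0) => t0;
    [left|right; rewrite ts].
have mN : measurable (A @^-1` `]-oo, 0[) by exact: mpre (measurable_itv _).
have mI : measurable (A @^-1` `[0, s]) by exact: mpre (measurable_itv _).
rewrite probability_setC; last exact: measurableU.
rewrite measureU//; last first.
  rewrite -subset0 => z [] /=; rewrite !in_itv/= => z0 /andP[z0' _].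
  by move: z0; rewrite ltNge z0'.
rewrite [X in (_ - (X + _))%E]PAlt0 add0e [X in (_ - X)%E](PA (measurable_itv _)).
move: s0; rewrite le_eqVlt => /predU1P[<-|s0].
  rewrite set_itv1 mulr0 expR0 /exponential_prob integral_set1 ?sube0//.
rewrite exponential_prob_itv0c// -!EFinB; congr EFin; ring.
Qed.

Let M (y : R) (t : T) : R := Num.max 0 (Num.min (A t) y).

Let mM y : measurable_fun [set: T] (M y).
Proof. by apply: measurable_maxr => //; exact: measurable_minr. Qed.

Let EM (y : R) : 0 <= y ->
  ('E_P[M y] = (lambda^-1 * (1 - expR (- lambda * y)))%:E)%E.
Proof.
move=> y0.
pose X : {RV P >-> R} := mfun_Sub (mem_set (mM y)).
have XE : (X : T -> R) = M y by [].
rewrite -XE ge0_expectation_ccdf; last first.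
  by move=> t; rewrite XE /M le_max lexx.
transitivity (\int[lebesgue_measure]_(s in `[0%R, y[)
   (lambda^-1%:E * (exponential_pdf lambda s)%:E))%E.
  rewrite [LHS]integral_mkcond [RHS]integral_mkcond; apply: eq_integral => s _.
  rewrite !patchE.
  have [s0|s0] := leP 0 s; last first.
    by rewrite !memNset//= in_itv/= ?andbT leNgt s0.
  rewrite mem_set/= ?in_itv/= ?s0//.
  have [sy|ys] := ltP s y.
    rewrite mem_set/= ?in_itv/= ?s0 ?sy// -EFinM exponential_pdfE//.
    rewrite mulrA mulVf ?gt_eqF// mul1r -(PAgt s0).
    congr (P _); apply/seteqP; split => t/=; rewrite !in_itv/= !andbT ?XE /M.
      by rewrite lt_max ltNge s0/= lt_min => /andP[].
    by rewrite lt_max lt_min sy andbT => ->; rewrite orbT.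
  rewrite memNset/= ?in_itv/= ?s0 ?ltNge ?ys//.
  rewrite /ccdf /distribution /pushforward /= (_ : _ @^-1` _ = set0) ?measure0//.
  rewrite -subset0 => t/=; rewrite !in_itv/= !andbT ?XE /M.
  by rewrite lt_max ltNge s0/= lt_min (ltNge s y) ys andbF.
have mpdf D : measurable D ->
    measurable_fun D (fun s => (exponential_pdf lambda s)%:E).
  move=> _; apply/measurable_EFinP/measurable_funTS.
  exact: measurable_exponential_pdf.
rewrite ge0_integralZl_EFin//; last 3 first.
- by move=> s _; rewrite lee_fin exponential_pdf_ge0// ltW.
- exact: mpdf.
- by rewrite invr_ge0 ltW.
move: y0; rewrite le_eqVlt => /predU1P[<-|y0].
  by rewrite set_itvco0 integral_set0 mulr0 expR0 subrr mulr0 mule0.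
rewrite -[X in (_ * X)%E](_ : exponential_prob lambda `[0%R, y] = _); last first.
  rewrite /exponential_prob -integral_itv_bndo_bndc//; exact: mpdf.
by rewrite exponential_prob_itv0c// -EFinB -EFinM.
Qed.

Let integrableM y : M y \in Lfun P 1.
Proof.
apply/Lfun1_integrable; apply: measurable_bounded_integrable => //.
  by rewrite -ge0_fin_numE// fin_num_measure.
exists `|y|; split; first by rewrite num_real.
move=> z yz t _ /=; rewrite /M ger0_norm ?le_max ?lexx//.
rewrite ge_max ge_min; apply/andP; split.
  by rewrite (le_trans _ (ltW yz)).
by apply/orP; right; rewrite (le_trans (ler_norm _))// ltW.
Qed.

Let Emin (m x : R) : b <= x ->
  'E_P[fun t => (m * Num.min (b + A t) x)%R]%E =
  (m * (b + lambda^-1 * (1 - expR (- lambda * (x - b)))))%:E.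
Proof.
move=> bx.
transitivity ('E_P[(m \o* (cst b \+ M (x - b)))%R])%E.
  rewrite unlock; apply: ae_eq_integral => //.
  - apply/measurable_EFinP; apply: measurable_funM => //.
    by apply: measurable_minr => //; exact: measurable_funD.
  - apply/measurable_EFinP; apply: measurable_funM => //.
    by apply: measurable_funD => //; exact: mM.
  - apply: filterS A_ge0 => t At _ /=; congr EFin.
    rewrite mulrC; congr (_ * _).
    rewrite /M max_r ?le_min ?At ?subr_ge0// addr_minr.
    by congr Num.min; ring.
have Lb : (cst b : T -> R) \in Lfun P 1.
  by apply/Lfun1_integrable; exact: finite_measure_integrable_cst.
rewrite expectationZl; last by rewrite rpredD.
rewrite expectationD// expectation_cst EM ?subr_ge0//.
Qed.

Let Emin_lt (m x : R) : x <= b ->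
  'E_P[fun t => (m * Num.min (b + A t) x)%R]%E = (m * x)%:E.
Proof.
move=> xb; rewrite -(expectation_cst P) unlock; apply: ae_eq_integral => //.
  apply/measurable_EFinP; apply: measurable_funM => //.
  by apply: measurable_minr => //; exact: measurable_funD.
  by apply/measurable_EFinP.
apply: filterS A_ge0 => t At _ /=; congr (_ * _)%:E.
by rewrite min_r// (le_trans xb)// lerDl.
Qed.

Lemma centralized_profit_optimal_capacity :
  centralized_profit A c k r b (optimal_capacity c k r b lambda) =
  (optimal_profit c k r b lambda)%:E.
Proof.
have rk : 1 < (r - k) / c by rewrite ltr_pdivlMr// mul1r (lt_trans hrkc)//
  ltrBlDr ltrDl.
rewrite /centralized_profit /optimal_capacity Emin; last first.
  by rewrite lerDl mulr_ge0 ?invr_ge0 ?(ltW l0)// ln_ge0// ltW.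
rewrite addrAC subrr add0r mulrA mulNr mulfV ?gt_eqF// mulN1r expRN lnK; last first.
  by rewrite posrE (lt_trans _ rk).
rewrite /optimal_profit -EFinD; congr EFin; rewrite invf_div.
have c0' : c != 0 by rewrite gt_eqF.
have l0' : lambda != 0 by rewrite gt_eqF.
have rk0 : r - k != 0 by rewrite gt_eqF// (lt_trans c0)// -[c]mul1r -ltr_pdivlMr.
by field; rewrite l0'.
Qed.

Lemma centralized_profit_max (x : R) :
  (centralized_profit A c k r b x <= (optimal_profit c k r b lambda)%:E)%E.
Proof.
have rk : 1 < (r - k) / c by rewrite ltr_pdivlMr// mul1r (lt_trans hrkc)//
  ltrBlDr ltrDl.
have L0 := ln_gt0 rk.
have i0 : 0 < lambda^-1 by rewrite invr_gt0.
rewrite /centralized_profit /optimal_profit.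
set L := ln _ in L0 *; have eL : expR L = (r - k) / c.
  by rewrite /L lnK// posrE (lt_trans _ rk).
have rE : r - k = c * expR L by rewrite eL mulrC divfK// gt_eqF.
have key z : c * (1 + (L - z)) <= c * expR L * expR (- z).
  by rewrite -mulrA -expRD ler_pM2l// expR_ge1Dx.
have [bx|xb] := leP b x.
  rewrite Emin// -EFinD lee_fin.
  have xE : x - b = lambda^-1 * (lambda * (x - b)) by rewrite mulKf// gt_eqF.
  rewrite mulNr; set z := lambda * (x - b) in xE *.
  have K : 0 <= lambda^-1 * ((r - k) * expR (- z)) - lambda^-1 * (c * (1 + (L - z))).
    by rewrite subr_ge0 ler_pM2l// {1}rE key.
  have -> : x = b + lambda^-1 * z by rewrite -xE; ring.
  rewrite -subr_ge0; apply: (le_trans K).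
  by rewrite le_eqVlt; apply/orP; left; apply/eqP; ring.
rewrite Emin_lt ?(ltW xb)// -EFinD lee_fin.
have K1 : 0 <= lambda^-1 * (r - k) - lambda^-1 * (c * (1 + L)).
  rewrite subr_ge0 ler_pM2l// rE.
  by have := key 0; rewrite oppr0 expR0 mulr1 addr0.
have K2 : 0 <= (r - k - c) * b - (r - k - c) * x.
  by rewrite subr_ge0 ler_pM2l ?ltW// (lt_trans c0).
rewrite -subr_ge0.
apply: (le_trans (addr_ge0 K1 K2)).
by rewrite le_eqVlt; apply/orP; left; apply/eqP; ring.
Qed.

End centralized_benchmark.

(* Main.v *)
Require Import Defs.
From mathcomp Require Import all_boot all_order all_algebra.
From mathcomp Require Import all_classical all_reals all_analysis.
From mathcomp Require Import measurable_realfun ring lra.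

(** With [L = ln ((r - k) / c)], the optimal capacity is [x_opt = b + L / lambda],
    and the exponential tail gives [P (D > x_opt) = c / (r - k)]: the newsvendor
    critical ratio.

    Since [ln] is injective on the positive reals and [L > 0], a contract is
    coordinating exactly when [w + rho * lambda = r] ([coordinatingE]).  All
    these contracts induce the same capacity [x_opt], so they create the same
    total surplus and differ only in how they divide it.  At [x_opt] the expected
    sales are [b + 1 / lambda] minus a loss [P (D > x_opt) / lambda]; because
    [rho = (r - w) / lambda], the expected penalty compensates the OEM for
    exactly its share of this loss.  The OEM therefore earns
    [(r - w) * (b + 1 / lambda)] ([coordinating_oem_profit]) and the supplier
    [(w - k - c) * (b + 1 / lambda) - c * L / lambda]
    ([coordinating_supplier_profit]), with sum the centralized optimum.

    On the coordinating line the OEM thus gains what the supplier gives up.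
    Participation bounds the OEM's profit by the centralized optimum, and the
    bound is attained where the supplier's profit vanishes, which is the
    equation that defines [w_hat] ([w_hatE]).  Finally [rho_hat >= 0] is
    [ln y <= y - 1] at [y = (r - k) / c].

    The expected sales at [x_opt] are read off from the closed form of the
    centralized optimum; this requires their integrability, which holds because
    [b <= D] almost surely, so that sales are bounded ([sales_Lfun1]). *)

Set Implicit Arguments.
Unset Strict Implicit.

Import Order.TTheory GRing.Theory Num.Theory.
Import numFieldNormedType.Exports.
Local Open Scope ring_scope.

(** * Exponential tails *)

Lemma exponential_prob_itvcy (R : realType) (lambda s : R) :
  0 < lambda -> 0 < s ->
  exponential_prob lambda (`[s, +oo[)%classic = (expR (- lambda * s))%:E.
Proof.
move=> l0 s0.
have cexp : continuous (fun x : R^o => expR (- lambda * x)).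
  move=> z; apply: continuous_comp; last exact: continuous_expR.
  by apply: continuousM => //; apply: (@continuousN _ R^o); exact: cst_continuous.
rewrite /exponential_prob.
rewrite (@ge0_continuous_FTC2y _ _ (fun x => - expR (- lambda * x)) _ 0)//.
- by rewrite EFinN oppeK add0e.
- by move=> x _; apply: exponential_pdf_ge0; exact: ltW.
- apply: (@continuous_subspaceW R^o _ _ [set` `[0, +oo[%R]).
    by apply: subset_itvr; rewrite bnd_simp ltW.
  exact: within_continuous_exponential_pdf.
- rewrite -oppr0; apply: cvgN.
  rewrite (_ : (fun x => _) = (fun z => expR (- z)) \o (fun z => lambda * z));
    last by apply/funext => x /=; rewrite mulNr.
  apply: (@cvg_comp _ _ _ _ _ _ (pinfty_nbhs R)); last exact: cvgr_expR.
  exact: gt0_cvgMry.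
- by apply: cvgN; apply/cvg_at_right_filter; exact: cexp.
- move=> z; rewrite in_itv/= andbT => sz.
  by apply: derive1_exponential_pdf; rewrite in_itv/= andbT (lt_trans s0).
Qed.

(** The law has a density, so the endpoint carries no mass; the strict and the
    non-strict stockout events used by the two parties are equally likely. *)
Lemma exponential_prob_itvoy (R : realType) (lambda s : R) :
  0 < lambda -> 0 < s ->
  exponential_prob lambda (`]s, +oo[)%classic = (expR (- lambda * s))%:E.
Proof.
move=> l0 s0; rewrite -exponential_prob_itvcy// /exponential_prob.
rewrite integral_itv_obnd_cbnd//.
apply/measurable_EFinP/measurable_funTS; exact: measurable_exponential_pdf.
Qed.

(** * Demand with an exponential random part *)

Section demand.
Context (R : realType) (d : measure_display) (T : measurableType d).
Context (P : probability T R) (A : {RV P >-> R}).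
Context (b lambda : R) (l0 : 0 < lambda).
Context (Aexp : exponentially_distributed A lambda).
Local Open Scope classical_set_scope.
Local Open Scope ring_scope.

Lemma exponentially_distributed_ge0 : {ae P, forall t, 0 <= A t}.
Proof.
exists (A @^-1` `]-oo, 0[); split.
- exact: measurable_funPTI.
- have := Aexp (measurable_itv `]-oo, (0 : R)[).
  rewrite /distribution /pushforward /exponential_prob => ->.
  apply: integral0_eq => x /=; rewrite in_itv/= => x0.
  by rewrite lt0_exponential_pdf.
- by move=> t /= /negP; rewrite -ltNge in_itv.
Qed.

Lemma demand_gt_prob (x : R) : b < x ->
  P [set t | x < b + A t] = (expR (- lambda * (x - b)))%:E.
Proof.
move=> bx; rewrite -exponential_prob_itvoy ?subr_gt0// -Aexp//.
congr (P _); apply/seteqP; split => t /=;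
  by rewrite in_itv/= andbT ltrBlDl.
Qed.

Lemma demand_ge_prob (x : R) : b < x ->
  P [set t | x <= b + A t] = (expR (- lambda * (x - b)))%:E.
Proof.
move=> bx; rewrite -exponential_prob_itvcy ?subr_gt0// -Aexp//.
congr (P _); apply/seteqP; split => t /=;
  by rewrite in_itv/= andbT lerBlDl.
Qed.

Lemma measurable_demand : measurable_fun [set: T] (fun t => b + A t).
Proof. exact: measurable_funD. Qed.

Lemma measurable_demand_gt (x : R) : measurable [set t | x < b + A t].
Proof.
rewrite -[X in measurable X]setTI (_ : [set t | _] = (fun t => b + A t) @^-1` `]x, +oo[).
  exact: measurable_demand.
by apply/seteqP; split => t /=; rewrite in_itv/= andbT.
Qed.

Lemma measurable_demand_ge (x : R) : measurable [set t | x <= b + A t].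
Proof.
rewrite -[X in measurable X]setTI (_ : [set t | _] = (fun t => b + A t) @^-1` `[x, +oo[).
  exact: measurable_demand.
by apply/seteqP; split => t /=; rewrite in_itv/= andbT.
Qed.

(** Sales are bounded above by [x] everywhere, but bounded below by [min b x]
    only almost surely, because [A] may be negative on a null set. *)
Lemma sales_Lfun1 (x : R) : (fun t => Num.min (b + A t) x) \in Lfun P 1.
Proof.
have mS : measurable_fun [set: T] (fun t => Num.min (b + A t) x).
  by apply: measurable_minr => //; exact: measurable_demand.
apply/Lfun1_integrable/integrableP; split; first exact/measurable_EFinP.
apply: (@le_lt_trans _ _ (\int[P]_t (cst (`|b| + `|x|)%:E t))%E); last first.
  by rewrite integral_cst//= probability_setT mule1 ltry.
apply: ae_ge0_le_integral => //.
- exact/measurableT_comp/measurable_EFinP.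
- by move=> t _; rewrite lee_fin addr_ge0.
- apply: filterS exponentially_distributed_ge0 => t At _ /=.
  rewrite lee_fin ler_norml ge_min le_min.
  have b1 := lerNnormlW (lexx `|b|). have b2 := ler_norm b.
  have x1 := lerNnormlW (lexx `|x|). have x2 := ler_norm x.
  have b0 := normr_ge0 b. have x0 := normr_ge0 x.
  apply/andP; split; first by apply/andP; split; lra.
  by apply/orP; right; lra.
Qed.

End demand.

Lemma expectation_lincomb_indic (R : realType) (d : measure_display)
    (T : measurableType d) (P : probability T R) (X : T -> R) (B : set T)
    (a q m p : R) :
  X \in Lfun P 1 -> measurable B -> 'E_P[X]%E = m%:E -> P B = p%:E ->
  'E_P[fun t => (a * X t + q * \1_B t)%R]%E = (a * m + q * p)%:E.
Proof.
move=> X1 mB Em Pp.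
have B1 : (\1_B : T -> R) \in Lfun P 1.
  apply/Lfun1_integrable; exact: integrable_indic.
rewrite (_ : (fun t => _) = ((a \o* X) \+ (q \o* \1_B))%R); last first.
  by apply/funext => t /=; congr (_ + _); exact: mulrC.
rewrite expectationD ?expectationZl ?expectation_indic ?Em ?Pp//;
  exact: Lfun_scale.
Qed.

(** * Contracts *)

Section contracts.
Context (R : realType) (c k r b lambda : R).
Context (c0 : 0 < c) (hr : c < r - k - c) (l0 : 0 < lambda).

Lemma margin_gt0 : 0 < r - k.
Proof. by move: c0 hr; lra. Qed.

Lemma critical_ratio_gt1 : 1 < (r - k) / c.
Proof. by rewrite ltr_pdivlMr// mul1r; move: c0 hr; lra. Qed.

Lemma optimal_capacity_gt : b < optimal_capacity c k r b lambda.
Proof. by rewrite ltrDl mulr_gt0 ?invr_gt0// ln_gt0// critical_ratio_gt1. Qed.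

(** The optimal capacity is the quantile at which the stockout probability
    equals the critical ratio. *)
Lemma expR_optimal_capacity :
  expR (- lambda * (optimal_capacity c k r b lambda - b)) = c / (r - k).
Proof.
rewrite /optimal_capacity addrAC subrr add0r mulrA mulNr mulfV ?gt_eqF// mulN1r.
by rewrite expRN lnK ?invf_div// posrE (lt_trans _ critical_ratio_gt1).
Qed.

(** The value [0] of [ln] at nonpositive arguments differs from
    [ln ((r - k) / c) > 0], so a coordinating contract has a positive argument,
    where [ln] is injective. *)
Lemma coordinatingE (w rho : R) :
  coordinating c k r b lambda w rho <-> w + rho * lambda = r.
Proof.
split; last first.
  move=> <-; rewrite /coordinating /capacity_response /optimal_capacity.
  by rewrite (_ : w + rho * lambda - k = w - k + rho * lambda)//; ring.
have rk := critical_ratio_gt1.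
move=> /addrI /(mulfI (lt0r_neq0 _)); rewrite invr_gt0 => /(_ l0) lnE.
(* a nonpositive argument would force [ln ((r - k) / c) = 0] *)
have pos : 0 < (w - k + rho * lambda) / c.
  rewrite ltNge; apply/negP => /ln0 w0.
  by have := ln_gt0 rk; rewrite -lnE w0 ltxx.
have rk0 : 0 < (r - k) / c by exact: lt_trans rk.
have /(mulIf _) wE := ln_inj pos rk0 lnE.
have {}wE : w - k + rho * lambda = r - k by apply: wE; rewrite invr_eq0 gt_eqF.
by lra.
Qed.

(** As [b * lambda + 1 >= 1], it is enough that
    [c * ln ((r - k) / c) <= r - k - c], i.e. [ln y <= y - 1]. *)
Lemma rho_hat_ge0 : 0 <= b -> 0 <= rho_hat c k r b lambda.
Proof.
move=> b0; have rk := critical_ratio_gt1.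
rewrite /rho_hat mulr_ge0 ?invr_ge0 ?(ltW l0)// subr_ge0.
apply: (@le_trans _ _ (c * ln ((r - k) / c))).
  rewrite ler_wpM2r ?ln_ge0 ?(ltW rk)// ler_pdivrMr; last first.
    by rewrite ltr_wpDl// mulr_ge0// ltW.
  by rewrite ler_peMr ?(ltW c0)// lerDr mulr_ge0// ltW.
have := expR_ge1Dx (ln ((r - k) / c)).
rewrite lnK ?posrE ?(lt_trans _ rk)// ler_pdivlMr// mulrDl mul1r mulrC.
by lra.
Qed.

Lemma coordinating_hat :
  coordinating c k r b lambda (w_hat c k r b lambda) (rho_hat c k r b lambda).
Proof.
by apply/coordinatingE; rewrite /rho_hat mulrAC mulVf ?gt_eqF// /w_hat; ring.
Qed.

Context (d : measure_display) (T : measurableType d).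
Context (P : probability T R) (A : {RV P >-> R}).
Context (Aexp : exponentially_distributed A lambda).

(** Solves the closed form of the optimal centralized profit for the
    expectation that it contains. *)
Lemma expected_sales_optimal_capacity :
  'E_P[fun t => Num.min (b + A t)%R (optimal_capacity c k r b lambda)]%E =
  (b + lambda^-1 * (1 - c / (r - k)))%:E.
Proof.
have rk0 : r - k != 0 by rewrite gt_eqF// margin_gt0.
have S1 := sales_Lfun1 b Aexp (optimal_capacity c k r b lambda).
have := centralized_profit_optimal_capacity b c0 hr l0 Aexp.
rewrite /centralized_profit.
rewrite (_ : (fun t => _) = ((r - k) \o* (fun t =>
    Num.min (b + A t) (optimal_capacity c k r b lambda)))%R); last first.
  by apply/funext => t /=; rewrite mulrC.
rewrite expectationZl//; have := expectation_fin_num S1.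
move: ('E_P[_])%E => [m| |]// _; rewrite -EFinM -EFinD => -[mE].
congr EFin; apply: (mulfI rk0); move: mE.
rewrite /optimal_profit /optimal_capacity => /(canRL (addKr _)) ->.
have l0' : lambda != 0 by rewrite gt_eqF.
by field; rewrite rk0 l0'.
Qed.

(** On the coordinating line the coefficient of [P (D > x_opt)] collapses to
    [- (w - k + rho * lambda) / lambda = - (r - k) / lambda], independent of the
    contract; the supplier's profit is then affine in [w] alone. *)
Lemma coordinating_supplier_profit (w rho : R) :
  coordinating c k r b lambda w rho ->
  supplier_profit A c k b (capacity_response c k b lambda w rho) w rho =
  ((w - k - c) * (b + lambda^-1) - c / lambda * ln ((r - k) / c))%:E.
Proof.
move=> /[dup] -> /coordinatingE wr.
have rk0 : r - k != 0 by rewrite gt_eqF// margin_gt0.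
have l0' : lambda != 0 by rewrite gt_eqF.
have := demand_gt_prob l0 Aexp optimal_capacity_gt.
rewrite expR_optimal_capacity => Pgt.
rewrite /supplier_profit; under eq_fun do rewrite -mulNr.
rewrite (expectation_lincomb_indic _ _ _ _ expected_sales_optimal_capacity Pgt).
- rewrite -EFinD; congr EFin; rewrite /optimal_capacity.
  have -> : rho = (r - w) / lambda by rewrite -wr addrAC subrr add0r mulfK.
  by field; rewrite rk0 l0'.
- exact: sales_Lfun1 Aexp _.
- exact: measurable_demand_gt.
Qed.

(** The coefficient of [P (D > x_opt)] is [rho - (r - w) / lambda = 0]: the penalty
    cancels the OEM's loss from unmet demand. *)
Lemma coordinating_oem_profit (w rho : R) :
  coordinating c k r b lambda w rho ->
  oem_profit A c k r b lambda w rho = ((r - w) * (b + lambda^-1))%:E.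
Proof.
move=> /[dup] xE /coordinatingE wr; rewrite /oem_profit xE.
have rk0 : r - k != 0 by rewrite gt_eqF// margin_gt0.
have l0' : lambda != 0 by rewrite gt_eqF.
have := demand_ge_prob l0 Aexp optimal_capacity_gt.
rewrite expR_optimal_capacity => Pge.
rewrite (expectation_lincomb_indic _ _ _ _ expected_sales_optimal_capacity Pge).
- congr EFin.
  have -> : rho = (r - w) / lambda by rewrite -wr addrAC subrr add0r mulfK.
  by field; rewrite rk0 l0'.
- exact: sales_Lfun1 Aexp _.
- exact: measurable_demand_ge.
Qed.

(** [w_hat] is the wholesale price at which the supplier breaks even. *)
Lemma w_hatE : 0 <= b ->
  (w_hat c k r b lambda - k - c) * (b + lambda^-1) =
  c / lambda * ln ((r - k) / c).
Proof.
move=> b0; have l0' : lambda != 0 by rewrite gt_eqF.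
have bl : b * lambda + 1 != 0.
  by rewrite gt_eqF// ltr_wpDl// mulr_ge0// ltW.
by rewrite /w_hat; field; rewrite l0'.
Qed.

End contracts.

Theorem proposition4 (R : realType) (d : measure_display) (T : measurableType d)
    (P : probability T R) (A : {RV P >-> R}) (c k r b lambda : R)
    (hc : 0 < c) (hk : 0 <= k) (hr : c < r - k - c) (hb : 0 <= b)
    (hlambda : 0 < lambda) (hblambda : b <= lambda^-1)
    (hA : exponentially_distributed A lambda) :
  let what := w_hat c k r b lambda in
  let rhohat := rho_hat c k r b lambda in
  let pi_s :=
    supplier_profit A c k b (capacity_response c k b lambda what rhohat)
      what rhohat in
  let pi_m := oem_profit A c k r b lambda what rhohat in
  let Pi_star := (optimal_profit c k r b lambda)%:E in
  (forall w rho : R, w + rho * lambda = r ->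
     coordinating c k r b lambda w rho) /\
  0 <= rhohat /\
  coordinating c k r b lambda what rhohat /\
  (forall w rho : R, coordinating c k r b lambda w rho ->
     supplier_participates A c k b lambda w rho ->
     (oem_profit A c k r b lambda w rho <= pi_m)%E) /\
  pi_s = 0%E /\
  pi_m = Pi_star /\
  (pi_s + pi_m)%E = Pi_star.
Proof.
move=> what rhohat pi_s pi_m Pi_star.
have coord : coordinating c k r b lambda what rhohat by exact: coordinating_hat.
have wE : (what - k - c) * (b + lambda^-1) = c / lambda * ln ((r - k) / c).
  exact: w_hatE.
have pi_s0 : pi_s = 0%E.
  by rewrite /pi_s (coordinating_supplier_profit hc hr hlambda hA coord) wE subrr.
have pi_mE : pi_m = Pi_star.
  rewrite /pi_m (coordinating_oem_profit hc hr hlambda hA coord).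
  by congr EFin; rewrite /optimal_profit -wE; ring.
split; first by move=> w rho wr; apply/coordinatingE.
split; first exact: rho_hat_ge0.
split=> //; split; last by rewrite pi_s0 pi_mE add0e.
(* the two profits sum to the optimum, so nonnegativity of one bounds the other *)
move=> w rho wcoord; rewrite /supplier_participates.
rewrite (coordinating_supplier_profit hc hr hlambda hA wcoord).
rewrite (coordinating_oem_profit hc hr hlambda hA wcoord) pi_mE.
rewrite !lee_fin /optimal_profit; lra.
Qed.
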